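(* Let $p$ be a prime and $k,\ell,m$ integers with $k>0$ and $\ell,m\ge 0$; put $q=p^k$, $Q=p^{\ell}$, $R=p^m$. Let $c\in\mathbb{F}_{q^3}$ and define \[ f(X)=(X^q-X)^{Q+1}+c^{q^2}X^{q^2R}+c^{q}X^{qR}+cX^{R}, \] i.e. $f(X)=X^{Q+1}\circ(X^q-X)+(X^{q^2}+X^q+X)\circ cX^{R}$. Then $f(X)$ permutes $\mathbb{F}_{q^3}$ if and only if $\gcd(q-1,Q+1)=1$ and $\operatorname{Tr}_{\mathbb{F}_{q^3}/\mathbb{F}_q}(c)\ne 0$. Equivalently, $f(X)$ permutes $\mathbb{F}_{q^3}$ if and only if $p=2$, $\operatorname{ord}_2(k)\le\operatorname{ord}_2(\ell)$, and $c^{q^2}+c^q+c\ne 0$.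
   Context: A polynomial permutes $\mathbb{F}_{q^3}$ if the induced map $\mathbb{F}_{q^3}\to\mathbb{F}_{q^3}$ is a bijection. $\operatorname{Tr}_{\mathbb{F}_{q^3}/\mathbb{F}_q}(c)=c^{q^2}+c^q+c$. For a nonzero integer $N$, $\operatorname{ord}_2(N)$ is the largest integer $s\ge0$ with $2^s\mid N$, and $\operatorname{ord}_2(0)=\infty$. *)

(* Defs.v *)
From mathcomp Require Import all_boot all_order all_algebra all_field.
Set Implicit Arguments. Unset Strict Implicit. Unset Printing Implicit Defensive.
Import GRing.Theory.
Local Open Scope ring_scope.

(* 2-adic valuation with ord_2(0) = infinity, encoded as None. *)
Definition ord2 (n : nat) : option nat :=
  if n == 0%N then None else Some (logn 2 n).

Definition ord_le (a b : option nat) : bool :=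
  match a, b with
  | _, None => true
  | None, Some _ => false
  | Some x, Some y => (x <= y)%N
  end.

Definition tr3 (F : fieldType) (q : nat) (c : F) : F :=
  c ^+ (q ^ 2) + c ^+ q + c.

Definition fmap (F : fieldType) (q Q R : nat) (c : F) (x : F) : F :=
  (x ^+ q - x) ^+ (Q + 1) + c ^+ (q ^ 2) * x ^+ (q ^ 2 * R)
  + c ^+ q * x ^+ (q * R) + c * x ^+ R.

(* Main.v *)
(* Write [q, Q, R] as in the statement, [L x = x^q - x] and [V] for the kernel
   of the trace.  Then [L (f x) = L ((L x)^(Q+1))], and [f (x + a) = f x + a^R
   Tr c] for [a] in F_q, so [f] is injective iff [Tr c != 0] and
   [y |-> L (y^(Q+1))] is injective on [V].

   A nontrivial (Q+1)-st root of unity [a] in F_q breaks the latter, since [y]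
   and [a y] have the same image.  Conversely, if gcd(q-1, Q+1) = 1, two points
   [y] and [y + d] of [V] with the same image yield, by writing [y] in the basis
   [d, d^q] of [V], an element [s] of F_q with [s^Q + s + 1 = 0].  As [p = 2] and
   ord_2 k <= ord_2 l, there is an odd [n] with [k | n l]; iterating
   [s^Q = s + 1] gives [s = s^(Q^n) = s + n = s + 1], a contradiction. *)
Require Import Defs.
From mathcomp Require Import all_boot all_order all_algebra all_field.
From mathcomp Require Import all_fingroup all_solvable.
From mathcomp Require Import ring zify.
Set Implicit Arguments. Unset Strict Implicit. Unset Printing Implicit Defensive.
Import GRing.Theory.
Local Open Scope ring_scope.

(** * Powers of the characteristic and cube roots of unity *)

Lemma coprime_expr_eq1 (K : fieldType) (x : K) (m n : nat) :
  (0 < m)%N -> coprime m n -> x ^+ m = 1 -> x ^+ n = 1 -> x = 1.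
Proof.
move=> m_gt0 /eqP cmn xm xn; case: (egcdnP n m_gt0) => km kn.
rewrite cmn => def_km _; have := congr1 (fun j => x ^+ j) def_km.
by rewrite exprD expr1 !(mulnC _ m, mulnC _ n) !exprM xm xn !expr1n mul1r.
Qed.

Lemma frobE (K : fieldType) (n : nat) : [pchar K].-nat n ->
  ((forall x y : K, ((x + y) ^+ n = x ^+ n + y ^+ n)%R) *
   (forall x : K, ((- x) ^+ n = - x ^+ n)%R) *
   (forall x y : K, ((x * y) ^+ n = x ^+ n * y ^+ n)%R) *
   (forall x : K, (x^-1 ^+ n = (x ^+ n)^-1)%R))%type.
Proof.
move=> Kn; do !split=> *.
- exact: exprDn_pchar.
- exact: exprNn_pchar.
- exact: exprMn.
- exact: exprVn.
Qed.

Lemma cube_root_neq0 (K : fieldType) (w : K) : w ^+ 2 + w + 1 = 0 -> w != 0.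
Proof. by apply: contra_eq_neq => ->; rewrite expr0n !add0r oner_eq0. Qed.

Lemma cube_root_expr3 (K : fieldType) (w : K) :
  w ^+ 2 + w + 1 = 0 -> w ^+ 3 = 1.
Proof.
move=> w_root.
have -> : w ^+ 3 = (w - 1) * (w ^+ 2 + w + 1) + 1 by ring.
by rewrite w_root mulr0 add0r.
Qed.

(** * From a collision on the trace kernel to a root of [s^Q + s + 1] *)

Section KernelOfTrace.

Variables (K : fieldType) (q Q : nat).
Hypotheses (Kq : [pchar K].-nat q) (KQ : [pchar K].-nat Q).
Hypotheses (K2 : 2%N \in [pchar K]) (cqQ : coprime (Q + 1) (q - 1)).

Let qgt0 : (0 < q)%N. Proof. by case/andP: Kq. Qed.
Let frobq := frobE Kq.
Let frobQ := frobE KQ.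

Lemma fixed_expr_pred (x : K) : x != 0 -> x ^+ q = x -> x ^+ (q - 1) = 1.
Proof.
by move=> x0 xq; apply: (mulIf x0); rewrite -exprSr subn1 prednK // mul1r.
Qed.

(** [x^Q] is again a root of X^2 + X + 1, hence [x] or [x^2]; the latter would give
    [x^(Q+1) = x^3 = 1]. With [x^(q-1) = 1], coprimality would then force [x = 1], not a root in
    characteristic 2. *)
Lemma cube_root_frob (x : K) :
  x ^+ q = x -> x ^+ 2 + x + 1 = 0 -> x ^+ Q = x /\ x ^+ (Q + 1) != 1.
Proof.
move=> xq x_root.
have x0 := cube_root_neq0 x_root.
have nQ1 : x ^+ (Q + 1) != 1.
  apply/eqP=> xQ1.
  have x1 : x = 1.
    by apply: coprime_expr_eq1 cqQ xQ1 (fixed_expr_pred x0 xq); rewrite addn1.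
  move: x_root; rewrite x1 expr1n (addrr_pchar2 K2) add0r => /eqP.
  by rewrite oner_eq0.
split=> //.
have : (x ^+ Q - x) * (x ^+ Q - x ^+ 2) = 0.
  have xQ_root : (x ^+ Q) ^+ 2 + x ^+ Q + 1 = 0.
    rewrite -exprM mulnC exprM -(expr1n K Q) -!exprDn_pchar //.
    by rewrite x_root expr0n; case: (Q) KQ.
  have -> : (x ^+ Q - x) * (x ^+ Q - x ^+ 2) =
      ((x ^+ Q) ^+ 2 + x ^+ Q + 1) + (x - 1 - x ^+ Q) * (x ^+ 2 + x + 1)
    by ring.
  by rewrite xQ_root x_root mulr0 addr0.
move/eqP; rewrite mulf_eq0 !subr_eq0 => /orP[/eqP//|/eqP xQ2].
by case/eqP: nQ1; rewrite addn1 exprSr xQ2 -exprSr cube_root_expr3.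
Qed.

(* The last hypothesis says that [(y + d)^(Q+1) - y^(Q+1)] is fixed by
   [x |-> x^q].  With [e = d^q], the vectors [d] and [e] are dependent over the
   fixed field exactly when [d^2 + d e + e^2 = 0]; then [s] is the component of
   [y / d] in the fixed field. *)
Lemma artin_schreier_dependent (y d : K) :
    d != 0 -> (d ^+ q) ^+ q = - d - d ^+ q -> (y ^+ q) ^+ q = - y - y ^+ q ->
    d ^+ 2 + d * d ^+ q + (d ^+ q) ^+ 2 = 0 ->
    (y ^+ Q * d + y * d ^+ Q + d ^+ Q * d) ^+ q =
      y ^+ Q * d + y * d ^+ Q + d ^+ Q * d ->
  exists2 s : K, s ^+ q = s & s ^+ Q + s + 1 = 0.
Proof.
move=> d0 dqq yqq D0 P_fixed.
set w := d ^+ q / d; have dq : d ^+ q = w * d by rewrite divfK.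
have w_root : w ^+ 2 + w + 1 = 0.
  apply: (mulIf (expf_neq0 2 d0)); rewrite mul0r -[RHS]D0 dq; ring.
have wq : w ^+ q = w.
  rewrite /w !frobq dqq dq.
  have -> : - d - w * d = w ^+ 2 * d - (w ^+ 2 + w + 1) * d by ring.
  rewrite w_root mul0r subr0; field.
  by rewrite d0 cube_root_neq0.
have [wQ wQ1] := cube_root_frob wq w_root; have w3 := cube_root_expr3 w_root.
clearbody w.
have w1 : 1 - w != 0.
  by rewrite subr_eq0; apply: contraNneq wQ1 => <-; rewrite expr1n.
set Y := y / d; have def_y : y = Y * d by rewrite divfK.
clearbody Y.
have Yqq : (Y ^+ q) ^+ q = - w ^+ 2 * Y ^+ q - w * Y.
  have w0 := cube_root_neq0 w_root.
  apply: (mulIf (mulf_neq0 (expf_neq0 2 w0) d0)).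
  move: yqq; rewrite def_y !frobq !dq !frobq wq dq => yqq.
  have -> : (Y ^+ q) ^+ q * (w ^+ 2 * d) = (Y ^+ q) ^+ q * (w * (w * d)) by ring.
  rewrite yqq.
  have -> : (- w ^+ 2 * Y ^+ q - w * Y) * (w ^+ 2 * d) =
     - (w ^+ 3 * w * Y ^+ q * d) - w ^+ 3 * Y * d by ring.
  rewrite w3; ring.
(* With T the q-power map, [Yqq] says that (T - 1)(T - w) kills [Y]. So [S] is fixed, and
   [S / (1 - w)] is the component of [Y] in the fixed field. *)
pose S := Y ^+ q - w * Y.
have Sq : S ^+ q = S.
  rewrite /S !frobq Yqq wq.
  have -> : - w ^+ 2 * Y ^+ q - w * Y - w * Y ^+ q =
      Y ^+ q - w * Y - (w ^+ 2 + w + 1) * Y ^+ q by ring.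
  by rewrite w_root mul0r subr0.
(* Divided by [d^(Q+1)], [P_fixed] reads w^2 (Y^(qQ) + Y^q + 1) = Y^Q + Y + 1; multiply by [w] and
   use [w^3 = 1]. *)
have SQ : S ^+ Q + S + (1 - w) = 0.
  have dQ0 : d ^+ Q != 0 by rewrite expf_neq0.
  apply: (mulIf (mulf_neq0 dQ0 d0)); rewrite mul0r.
  move: P_fixed; rewrite def_y /S !(frobq, frobQ) wQ.
  rewrite ![(_ ^+ Q) ^+ q]exprAC dq !frobQ wQ.
  move: (Y ^+ Q) (Y ^+ q) ((Y ^+ q) ^+ Q) (d ^+ Q) => a b ab D.
  move=> /eqP; rewrite -subr_eq0 => /eqP P0.
  have -> : (ab - w * a + (b - w * Y) + (1 - w)) * (D * d)
     = w ^+ 3 * (ab + b + 1) * (D * d) - w * (a + Y + 1) * (D * d)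
       + (1 - w ^+ 3) * (ab + b + 1) * (D * d) by ring.
  rewrite {2}w3 subrr !mul0r addr0 -[RHS](mulr0 w) -P0; ring.
clearbody S; exists (S / (1 - w)).
  by rewrite !frobq Sq wq expr1n.
apply: (mulIf w1); rewrite mul0r !frobQ wQ expr1n -[RHS]SQ; by field.
Qed.

(* Here [y = s d + t e] with [s], [t] in the fixed field, and the hypothesis
   becomes [A U = B (U + U^q)] with [A = s^Q + s + 1], [B = t^Q + t] and
   [U = e^(Q+1) - d^(Q+1)].  If [B != 0], then [U^q = w U] for a primitive cube
   root of unity [w], and the solution is [s - (1 + w) t]. *)
Lemma artin_schreier_independent (y d : K) :
    d != 0 -> (d ^+ q) ^+ q = - d - d ^+ q -> (y ^+ q) ^+ q = - y - y ^+ q ->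
    d ^+ 2 + d * d ^+ q + (d ^+ q) ^+ 2 != 0 ->
    (y ^+ Q * d + y * d ^+ Q + d ^+ Q * d) ^+ q =
      y ^+ Q * d + y * d ^+ Q + d ^+ Q * d ->
  exists2 s : K, s ^+ q = s & s ^+ Q + s + 1 = 0.
Proof.
move=> d0 dqq yqq; set e := d ^+ q in dqq *; set z := y ^+ q in yqq *.
set D := _ + _ + _ => D0 P_fixed.
(* Cramer's rule for [y = s d + t e] and its q-th power [z = s e - t (d + e)]; the determinant is
   [- D]. *)
pose s := (y * (d + e) + z * e) / D; pose t := (e * y - d * z) / D.
have Dq : D ^+ q = D.
  rewrite /D !frobq -!/e dqq; ring.
have sq : s ^+ q = s.
  by rewrite /s exprMn exprVn Dq !frobq -/e -/z dqq yqq; congr (_ / _); ring.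
have tq : t ^+ q = t.
  by rewrite /t exprMn exprVn Dq !frobq -/e -/z dqq yqq; congr (_ / _); ring.
have def_y : y = s * d + t * e by rewrite /s /t /D; field.
clearbody s t; clear Dq yqq z.
pose A := s ^+ Q + s + 1; pose B := t ^+ Q + t.
have Aq : A ^+ q = A by rewrite /A !frobq expr1n exprAC sq.
have Bq : B ^+ q = B by rewrite /B !frobq exprAC tq.
pose U := e ^+ Q * e - d ^+ Q * d.
have Uq : U ^+ q = d ^+ Q * e + e ^+ Q * d + d ^+ Q * d.
  by rewrite /U !frobq ![(_ ^+ Q) ^+ q]exprAC -/e dqq !frobQ; ring.
have Uqq : (U ^+ q) ^+ q = - U - U ^+ q.
  by rewrite Uq !frobq ![(_ ^+ Q) ^+ q]exprAC -/e dqq !frobQ /U; ring.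
have rel : A * U = B * (U + U ^+ q).
  move: P_fixed; rewrite def_y Uq !(frobq, frobQ) ![(_ ^+ Q) ^+ q]exprAC.
  rewrite sq tq -/e dqq !frobQ /A /B /U.
  move: (s ^+ Q) (t ^+ Q) (e ^+ Q) (d ^+ Q) => s' t' e' d'.
  move=> /eqP; rewrite -subr_eq0 => /eqP P0.
  by apply/eqP; rewrite -subr_eq0 -P0; apply/eqP; ring.
(* If [U = 0], then [w = e / d] has [w^(Q+1) = 1], while [U^q = 0] reads [w + w^Q + 1 = 0].
   Multiplying by [w] gives [w^2 + w + 1 = 0], that is, [D = 0]. *)
have U0 : U != 0.
  apply/eqP=> U0.
  have Uq0 := esym Uq; rewrite U0 expr0n eqn0Ngt qgt0 mulr0n in Uq0.
  pose w := e / d; have def_e : e = w * d by rewrite divfK.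
  clearbody w.
  have wQ1 : w ^+ (Q + 1) = 1.
    apply: (mulIf (mulf_neq0 (expf_neq0 Q d0) d0)); rewrite mul1r.
    apply/eqP; rewrite -subr_eq0 -[0]U0 /U; apply/eqP.
    rewrite def_e !frobQ addn1 exprSr; ring.
  have w_root : w ^+ 2 + w + 1 = 0.
    move: wQ1; rewrite addn1 exprSr => wQ1.
    apply: (mulIf (mulf_neq0 (expf_neq0 Q d0) d0)).
    rewrite mul0r -[RHS](mulr0 w) -Uq0 def_e !frobQ.
    have -> : w * (d ^+ Q * (w * d) + w ^+ Q * d ^+ Q * d + d ^+ Q * d) =
       (w ^+ 2 + w + w ^+ Q * w) * (d ^+ Q * d) by ring.
    by rewrite wQ1.
  case/eqP: D0; rewrite /D def_e.
  have -> : d ^+ 2 + d * (w * d) + (w * d) ^+ 2 = (w ^+ 2 + w + 1) * d ^+ 2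
    by ring.
  by rewrite w_root mul0r.
have [B0|B0] := eqVneq B 0.
  exists s => //; apply/eqP; rewrite -/A.
  by move/eqP: rel; rewrite B0 mul0r mulf_eq0 (negPf U0) orbF.
pose w := A / B - 1.
have defA : A = (1 + w) * B by rewrite /w; field.
have defUq : U ^+ q = w * U.
  apply: (mulfI B0).
  have -> : B * U ^+ q = B * (U + U ^+ q) - B * U by ring.
  by rewrite -rel defA; ring.
have wq : w ^+ q = w by rewrite /w frobq exprMn exprVn Aq Bq frobq expr1n.
clearbody w.
have w_root : w ^+ 2 + w + 1 = 0.
  apply: (mulIf U0); rewrite mul0r; move/eqP: Uqq.
  by rewrite defUq frobq wq defUq -subr_eq0 => /eqP <-; ring.
have [wQ _] := cube_root_frob wq w_root.
(* As [w^Q = w], the equation for this element is [A - (1 + w) B = 0]. *)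
exists (s - (1 + w) * t).
  by rewrite !frobq expr1n wq sq tq.
apply/eqP; rewrite !frobQ expr1n wQ -subr_eq0 -(subrr A) {2}defA /A /B.
by apply/eqP; ring.
Qed.

End KernelOfTrace.

(** * Absence of roots, and arithmetic of the gcd condition *)

Lemma artin_schreier_free (K : fieldType) (k l n : nat) (s : K) :
    2%N \in [pchar K] -> odd n -> (k %| n * l)%N ->
  s ^+ (2 ^ k) = s -> s ^+ (2 ^ l) + s + 1 != 0.
Proof.
move=> K2 n_odd /dvdnP[j nl] sk; apply/eqP=> s_root.
have K2l : [pchar K].-nat (2 ^ l)%N by rewrite pnatX pnatE // K2.
have sl : s ^+ (2 ^ l) = s + 1.
  rewrite -[LHS](addrK (s + 1)) addrA s_root add0r -[RHS]opprK.
  by rewrite !(oppr_pchar2 K2).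
have iter_l i : s ^+ (2 ^ (i * l)) = s + i%:R.
  elim: i => [|i IHi]; first by rewrite mul0n expn0 expr1 addr0.
  rewrite mulSn expnD exprM sl exprDn_pchar ?expr1n.
    by rewrite IHi -addrA natr1.
  by rewrite pnatX pnatE // K2.
have iter_k i : s ^+ (2 ^ (i * k)) = s.
  elim: i => [|i IHi]; first by rewrite mul0n expn0 expr1.
  by rewrite mulSn expnD exprM sk.
move: (iter_l n); rewrite nl iter_k => /esym/eqP.
rewrite -subr_eq0 addrC addKr -(odd_double_half n) n_odd -addnn !natrD.
by rewrite (addrr_pchar2 K2) addr0 oner_eq0.
Qed.

(** Modulo [d], [x] is -1, and so are its odd powers. *)
Lemma dvdn_succ_exp_odd (d x n : nat) :
  odd n -> (d %| x + 1)%N -> (d %| x ^ n + 1)%N.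
Proof.
move=> n_odd; case: x => [|x] d_x1.
  by rewrite exp0n //; case: n n_odd.
rewrite -(odd_double_half n) n_odd add1n.
elim: n./2 => [|m IHm]; first by rewrite expn1.
rewrite doubleS -(dvdn_addl _ (dvdn_mulr x d_x1)).
have -> : (x.+1 ^ m.*2.+3 + 1 + (x.+1 + 1) * x =
           x.+1 ^ 2 * (x.+1 ^ m.*2.+1 + 1))%N by rewrite !expnS; ring.
by rewrite dvdn_mull.
Qed.

Lemma dvdn_pred_exp (d x n : nat) :
  (d %| x - 1)%N -> (d %| x ^ n - 1)%N.
Proof. by rewrite !subn1 predn_exp; apply: dvdn_mulr. Qed.

(** This form makes an odd iterate of the Q-power map an iterate of the q-power map. The witness is
    the odd part of [k], or 1 when [l = 0]. *)
Lemma ord_leP (k l : nat) : (0 < k)%N ->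
  reflect (exists2 n, odd n & (k %| n * l)%N) (ord_le (ord2 k) (ord2 l)).
Proof.
move=> k_gt0; rewrite /ord2 (gtn_eqF k_gt0).
have [->|l_gt0] := posnP l; first by left; exists 1%N.
rewrite /=; apply: (iffP idP) => [le_kl | [n n_odd k_nl]].
  exists (k`_2^')%N; first by rewrite odd_2'nat part_pnat.
  rewrite -{1}(partnC 2%N k_gt0) mulnC dvdn_mul // p_part.
  by rewrite pfactor_dvdn.
have n_gt0 : (0 < n)%N by case: n n_odd {k_nl}.
rewrite -[logn 2 l]add0n.
rewrite -[X in (X + _)%N](_ : logn 2 n = 0%N); last first.
  by rewrite lognE /= dvdn2 n_odd andbF.
by rewrite -lognM // dvdn_leq_log // muln_gt0 n_gt0.
Qed.

Lemma gcd_ord2 (p k l : nat) : prime p -> (0 < k)%N ->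
  gcdn (p ^ k - 1) (p ^ l + 1) = 1%N <-> p = 2%N /\ ord_le (ord2 k) (ord2 l).
Proof.
move=> p_pr k_gt0; split=> [gcd1 | [-> /(ord_leP _ k_gt0)[n n_odd /dvdnP[j nl]]]].
  have [p2|p_odd] := even_prime p_pr; last first.
    suff: (2 %| 1)%N by [].
    rewrite -[X in (_ %| X)%N]gcd1 dvdn_gcd !dvdn2 oddB ?expn_gt0 ?prime_gt0 //.
    by rewrite oddD !oddX p_odd !orbT.
  split=> //; rewrite {p p_pr}p2 in gcd1.
  rewrite /ord2 (gtn_eqF k_gt0); have [//|l_gt0] := posnP l.
  rewrite /= leqNgt; apply/negP=> lt_lk.
  set b := logn 2 l in lt_lk.
  (* This number divides [2^(2^(b+1)) - 1], hence [2^k - 1]; it divides [2^l + 1] because [l / 2^b]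
     is odd. *)
  suff: (2 ^ (2 ^ b) + 1 %| 1)%N by rewrite dvdn1 addn1 eqSS expn_eq0.
  rewrite -[X in (_ %| X)%N]gcd1 dvdn_gcd; apply/andP; split.
    have /dvdnP[j ->] : (2 ^ b.+1 %| k)%N by rewrite pfactor_dvdn.
    rewrite mulnC expnM dvdn_pred_exp // expnS mulnC expnM.
    by rewrite -[X in (_ %| _ - X)%N](exp1n 2) subn_sqr dvdn_mull.
  have def_l : (l = 2 ^ b * l`_2^')%N by rewrite -p_part partnC.
  by rewrite {1}def_l expnM dvdn_succ_exp_odd // odd_2'nat part_pnat.
set d := gcdn _ _.
(* [d] divides both [2^(n l) + 1] and [2^(n l) - 1]. *)
have d_2 : (d %| 2)%N.
  have d1 : (d %| 2 ^ (n * l) + 1)%N.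
    by rewrite mulnC expnM dvdn_succ_exp_odd // dvdn_gcdr.
  have d2 : (d %| 2 ^ (n * l) - 1)%N.
    by rewrite nl mulnC expnM dvdn_pred_exp // dvdn_gcdl.
  have -> : 2%N = (2 ^ (n * l) + 1 - (2 ^ (n * l) - 1))%N.
    by have := expn_gt0 2 (n * l); lia.
  by rewrite dvdn_sub.
have d_odd : odd d.
  apply: dvdn_odd (dvdn_gcdl _ _) _.
  by rewrite oddB ?expn_gt0 // oddX (gtn_eqF k_gt0).
have := dvdn_leq (ltn0Sn 1) d_2; case: d d_odd {d_2} => [|[|[|]]] //.
Qed.

(** * Collisions of [f] and the map [L] *)

Section TraceFibres.

Variables (F : finFieldType) (q Q R : nat) (c : F).
Hypotheses (Fq : [pchar F].-nat q) (FR : [pchar F].-nat R).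
Hypothesis cardF : #|F| = (q ^ 3)%N.

Let F_q3 (x : F) : x ^+ (q ^ 3) = x. Proof. by rewrite -cardF expf_card. Qed.

Let frobq := frobE Fq.
Let L (x : F) := x ^+ q - x.

Lemma frob_fixed_sub (x y : F) : L x = L y -> (x - y) ^+ q = x - y.
Proof.
move=> eqL; have def_xq : x ^+ q = L y + x by rewrite -eqL /L; ring.
by rewrite !frobq def_xq /L; ring.
Qed.

Lemma tr3_fixed (z : F) : tr3 q z ^+ q = tr3 q z.
Proof.
rewrite /tr3 !frobq -!exprM -expnSr F_q3.
by rewrite -[(q * q)%N]/(q ^ 2)%N; ring.
Qed.

(** The vanishing of the trace of [L x], solved for the q^2-power as the lemmas on the trace kernel
    require. *)
Lemma frob_sub_tr0 (x : F) : (L x ^+ q) ^+ q = - L x - L x ^+ q.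
Proof.
rewrite /L !frobq -!exprM (_ : q * (q * q) = q ^ 3)%N ?F_q3 //.
ring.
Qed.

Lemma fmapE (x : F) : fmap q Q R c x = L x ^+ (Q + 1) + tr3 q (c * x ^+ R).
Proof. by rewrite /fmap /tr3 !exprMn -!exprM ![(R * _)%N]mulnC !addrA. Qed.

Lemma fmap_frob_sub (x : F) : L (fmap q Q R c x) = L (L x ^+ (Q + 1)).
Proof. by rewrite {1 2}/L fmapE frobq tr3_fixed; ring. Qed.

Lemma fmap_translate (x a : F) : a ^+ q = a ->
  fmap q Q R c (x + a) = fmap q Q R c x + a ^+ R * tr3 q c.
Proof.
move=> aq; have aRq : (a ^+ R) ^+ q = a ^+ R by rewrite exprAC aq.
rewrite !fmapE /L !frobq aq (exprDn_pchar _ _ FR).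
rewrite [x ^+ q + a - _](_ : _ = x ^+ q - x); last by ring.
rewrite /tr3 expnS expn1 !exprM mulrDr !frobq !aRq; ring.
Qed.

(** X^q - X has at most [q < q^3] roots. *)
Lemma nonfixed_point : (1 < q)%N -> exists x : F, L x != 0.
Proof.
move=> q_gt1; apply/existsP; rewrite -[X in is_true X]negbK negb_exists.
apply/negP=> /forallP fix_all.
have szp : size ('X^q - 'X : {poly F}) = q.+1.
  by rewrite size_polyDl size_polyXn // size_polyN size_polyX.
have p0 : 'X^q - 'X != 0 :> {poly F} by rewrite -size_poly_eq0 szp.
have := max_poly_roots p0 _ (enum_uniq F).
have lt_q_q3 : (q < q ^ 3)%N by rewrite -{1}(expn1 q) ltn_exp2l.
rewrite szp -cardE cardF ltnS leqNgt lt_q_q3 => /implyP.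
rewrite implybF => /negP[]; apply/allP=> x _; rewrite rootE !hornerE.
by have := fix_all x; rewrite negbK.
Qed.
Lemma fmap_inj_tr3 : injective (fmap q Q R c) -> tr3 q c != 0.
Proof.
move=> f_inj; apply: contraTneq (oner_neq0 F) => c0; rewrite negbK.
have one_q : (1 : F) ^+ q = 1 by rewrite expr1n.
apply/eqP/f_inj; rewrite -[1]add0r (fmap_translate _ one_q).
by rewrite c0 mulr0 addr0.
Qed.

Lemma fmap_inj_coprime :
  (1 < q)%N -> injective (fmap q Q R c) -> gcdn (q - 1) (Q + 1) = 1%N.
Proof.
move=> q_gt1 f_inj; apply/eqP/negPn/negP; set d := gcdn _ _ => ncop.
have tr_c := fmap_inj_tr3 f_inj.
have d_gt1 : (1 < d)%N by rewrite ltn_neqAle eq_sym ncop gcdn_gt0 subn_gt0 q_gt1.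
have r_pr := pdiv_prime d_gt1; set r := pdiv d in r_pr.
have /dvdnP[i def_q] : (r %| q - 1)%N.
  exact: dvdn_trans (pdiv_dvd d) (dvdn_gcdl _ _).
have /dvdnP[j def_Q] : (r %| Q + 1)%N.
  exact: dvdn_trans (pdiv_dvd d) (dvdn_gcdr _ _).
(* Cauchy's theorem applies since [r] divides [q - 1], hence [q^3 - 1]. The resulting root of unity
   lies in F_q and its (Q+1)-st power is 1. *)
have [u _ ord_u] : {u : {unit F} | u \in [set: {unit F}] & #[u]%g = r}.
  apply: Cauchy => //; rewrite card_finField_unit cardF -subn1.
  by apply: dvdn_pred_exp; rewrite def_q dvdn_mull.
pose a : F := val u.
have ar : a ^+ r = 1 by rewrite /a -FinRing.val_unitX -ord_u expg_order.
have a1 : a != 1.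
  apply: contraTneq r_pr => a1; rewrite -ord_u.
  by have /eqP -> : u == 1%g; [rewrite -val_eqE; apply/eqP | rewrite order1].
have aq : a ^+ q = a.
  rewrite -(subnK (ltnW q_gt1)) exprD expr1 def_q mulnC exprM ar expr1n.
  by rewrite mul1r.
have aQ : a ^+ (Q + 1) = 1 by rewrite def_Q mulnC exprM ar expr1n.
have Lax x : L (a * x) = a * L x by rewrite /L exprMn aq mulrBr.
have [x Lx0] := nonfixed_point q_gt1.
have fixed_diff : (fmap q Q R c (a * x) - fmap q Q R c x) ^+ q
    = fmap q Q R c (a * x) - fmap q Q R c x.
  by apply: frob_fixed_sub; rewrite !fmap_frob_sub Lax exprMn aQ mul1r.
have R_inj : injective (fun y : F => y ^+ R).
  move=> y z /eqP; rewrite -subr_eq0 -!(frobE FR) expf_eq0 subr_eq0.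
  by case/andP=> _ /eqP.
have [/= Rrt rtK RrtK] := injF_bij R_inj.
set D := (_ - _) in fixed_diff.
(* [f (a x)] and [f x] differ by an element of F_q; translating [x] by this [b] makes up the
   difference, so injectivity forces [a x = x + b], and [L] gives [a = 1]. *)
pose b := Rrt (D / tr3 q c).
have bR : b ^+ R = D / tr3 q c by rewrite /b RrtK.
have bq : b ^+ q = b.
  by apply: R_inj; rewrite exprAC bR exprMn exprVn fixed_diff tr3_fixed.
have /f_inj xb : fmap q Q R c (x + b) = fmap q Q R c (a * x).
  by rewrite (fmap_translate _ bq) bR divfK // /D addrC subrK.
case/eqP: a1; apply: (mulIf Lx0); rewrite mul1r -Lax -xb.
by rewrite /L !frobq bq; ring.
Qed.

Lemma fmap_injective : 2%N \in [pchar F] -> [pchar F].-nat Q ->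
    coprime (Q + 1) (q - 1) ->
    (forall s : F, s ^+ q = s -> s ^+ Q + s + 1 != 0) ->
  tr3 q c != 0 -> injective (fmap q Q R c).
Proof.
move=> F2 FQ cqQ no_root tr_c x1 x2 eq_f.
have eqL : L x1 = L x2.
  apply/eqP; rewrite -subr_eq0; apply/negPn/negP=> d0.
  set d := L x1 - L x2 in d0.
  have dqq : (d ^+ q) ^+ q = - d - d ^+ q.
    rewrite /d; have := frob_sub_tr0 x1; have := frob_sub_tr0 x2.
    by move: (L x1) (L x2) => u v vqq uqq; rewrite !frobq uqq vqq; ring.
  (* The expression is the difference of the (Q+1)-st powers of [L x1 = L x2 + d] and [L x2]. *)
  have P_fixed : (L x2 ^+ Q * d + L x2 * d ^+ Q + d ^+ Q * d) ^+ q =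
      L x2 ^+ Q * d + L x2 * d ^+ Q + d ^+ Q * d.
    have -> : L x2 ^+ Q * d + L x2 * d ^+ Q + d ^+ Q * d =
        L x1 ^+ (Q + 1) - L x2 ^+ (Q + 1).
      rewrite /d; move: (L x1) (L x2) => u v.
      by rewrite !addn1 !exprSr !(frobE FQ); ring.
    by apply: frob_fixed_sub; rewrite -!fmap_frob_sub eq_f.
  have [D0|D0] := eqVneq (d ^+ 2 + d * d ^+ q + (d ^+ q) ^+ 2) 0.
    have [s sq /eqP] := artin_schreier_dependent Fq FQ F2 cqQ d0 dqq
      (frob_sub_tr0 x2) D0 P_fixed.
    exact/negP/no_root.
  have [s sq /eqP] := artin_schreier_independent Fq FQ F2 cqQ d0 dqq
    (frob_sub_tr0 x2) D0 P_fixed.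
  exact/negP/no_root.
(* Now [x1] and [x2] differ by an element of F_q, and the translation formula leaves
   [a^R Tr c = 0]. *)
pose a := x1 - x2.
have aq : a ^+ q = a by apply: frob_fixed_sub.
move: eq_f; rewrite -[x1](subrK x2) addrC -/a (fmap_translate _ aq).
move/eqP; rewrite -[X in _ == X]addr0 (inj_eq (addrI _)) mulf_eq0 (negPf tr_c).
by rewrite orbF expf_eq0 => /andP[_ /eqP->]; rewrite addr0.
Qed.

End TraceFibres.

Theorem theorem1p4 (p k l m : nat) (F : finFieldType) (c : F) :
  prime p -> (0 < k)%N -> #|F| = (p ^ (3 * k))%N ->
  let q := (p ^ k)%N in let Q := (p ^ l)%N in let R := (p ^ m)%N in
  (bijective (fmap q Q R c) <->
     (gcdn (q - 1) (Q + 1) = 1%N /\ tr3 q c != 0))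
  /\
  (bijective (fmap q Q R c) <->
     [/\ p = 2%N, ord_le (ord2 k) (ord2 l) & tr3 q c != 0]).
Proof.
move=> p_pr k_gt0 cardF q Q R.
have Fp : p \in [pchar F] by apply: card_finPcharP cardF p_pr.
have Fpow n : [pchar F].-nat (p ^ n)%N by rewrite pnatX pnatE // Fp.
have q_gt1 : (1 < q)%N by rewrite -(exp1n k) ltn_exp2r // prime_gt1.
have cardq : #|F| = (q ^ 3)%N by rewrite cardF mulnC expnM.
have gcdE := gcd_ord2 l p_pr k_gt0.
have main : bijective (fmap q Q R c) <->
    gcdn (q - 1) (Q + 1) = 1%N /\ tr3 q c != 0.
  split=> [/bij_inj f_inj | [cqQ tr_c]].
    split; first exact: fmap_inj_coprime (Fpow k) (Fpow m) cardq q_gt1 f_inj.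
    exact: fmap_inj_tr3 (Fpow k) (Fpow m) f_inj.
  have [p2 /(ord_leP _ k_gt0)[n n_odd k_nl]] := gcdE.1 cqQ.
  apply: injF_bij; apply: fmap_injective tr_c; rewrite /q /Q /R ?Fpow //.
  - by rewrite -p2.
  - by rewrite coprime_sym /coprime cqQ.
  move=> s; rewrite p2; apply: artin_schreier_free n_odd k_nl.
  by rewrite -p2.
split=> //; split=> [/main[/gcdE[]] // | [p2 le_kl tr_c]].
by apply/main; split=> //; apply/gcdE.
Qed.
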